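(* There is an algorithm that, given a point set $P=\{p_1,\ldots,p_n\}$ in general position and a distance function $d$, runs in $\tilde{O}(n\cdot\mathsf{OPT}^* )\le\tilde{O}(n^{2.5})$ time and, with probability at least $1-1/n^2$, returns a navigable graph $G$ on $P$ with $O(\mathsf{OPT}^*\log n)$ edges. Moreover, for each $p_i\in P$, the out-neighborhood of $p_i$ in $G$ has size $O(\mathsf{OPT}_i\log n)$.
   Context: A distance function on $P$ is any $d:P\times P\to\mathbb{R}_{\ge0}$ with $d(p_i,p_i)=0$ and $d(p_i,p_j)=d(p_j,p_i)>0$ for $i\ne j$ (no triangle inequality assumed), evaluable in $O(1)$ time. General position: points are distinct and $d(p_i,p_j)\ne d(p_i,p_k)$ for all $i$ and $j\ne k$. A directed graph $G=(P,E)$ is navigable if for all $p_i\ne p_j$ there is $p_k$ with $(p_i,p_k)\in E$ and $d(p_k,p_j)<d(p_i,p_j)$. $\mathsf{OPT}^*$ is the minimum number of edges of a navigable graph on $P$, and $\mathsf{OPT}_i$ is the minimum out-degree of $p_i$ over all navigable graphs on $P$ (equivalently, the minimum number of points $p_k$ such that every $p_j\ne p_i$ satisfies $d(p_k,p_j)<d(p_i,p_j)$ for one of them). $\tilde{O}$ hides polylogarithmic factors. *)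

(* Defs.v *)
From mathcomp Require Import all_boot all_order all_algebra.
From mathcomp Require Import reals exp.

Set Implicit Arguments.
Unset Strict Implicit.
Unset Printing Implicit Defensive.

Import Order.TTheory GRing.Theory Num.Theory.
Local Open Scope ring_scope.

(* The points p_1, ..., p_n are represented by their indices in 'I_n. *)

Definition distance (R : realType) (n : nat) (d : 'I_n -> 'I_n -> R) : Prop :=
  (forall i, d i i = 0) /\
  (forall i j, i != j -> d i j = d j i /\ 0 < d i j).

Definition general_position (R : realType) (n : nat) (d : 'I_n -> 'I_n -> R)
  : Prop :=
  forall i j k, j != k -> d i j != d i k.

Definition navigable (R : realType) (n : nat) (d : 'I_n -> 'I_n -> R)
    (E : {set 'I_n * 'I_n}) : bool :=
  [forall i, forall j, (i != j) ==>
    [exists k, ((i, k) \in E) && (d k j < d i j)]].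

Definition outnbr (n : nat) (E : {set 'I_n * 'I_n}) (i : 'I_n) : {set 'I_n} :=
  [set k | (i, k) \in E].

Lemma navigable_setT (R : realType) (n : nat) (d : 'I_n -> 'I_n -> R) :
  distance d -> navigable d [set: 'I_n * 'I_n].
Proof.
move=> [d0 dpos]; apply/forallP => i; apply/forallP => j; apply/implyP => ij.
by apply/existsP; exists j; rewrite in_setT d0; case: (dpos _ _ ij).
Qed.

(* The default [set: _] of these minima is navigable by [navigable_setT]. *)

Definition OPT (R : realType) (n : nat) (d : 'I_n -> 'I_n -> R) : nat :=
  #|[arg min_(E < [set: 'I_n * 'I_n] | navigable d E) #|E|]%N|.

Definition OPTi (R : realType) (n : nat) (d : 'I_n -> 'I_n -> R) (i : 'I_n)
  : nat :=
  #|outnbr [arg min_(E < [set: 'I_n * 'I_n] | navigable d E) #|outnbr E i|]%N i|.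

(* Model of computation: a randomized word RAM with structured control flow.
   - Integer data are words; all word operations are taken modulo
     2 ^ (c * (floor (log2 n) + 1)), where c is a constant attached to the
     program.  A program names finitely many word arrays, each indexed by words
     and initially 0; a scalar variable is an array used at index 0.
   - Real data are stored in separate arrays.  They can only be produced by
     evaluating d, copied, and compared.
   - Every command counts as one step.  The expressions occurring in a fixed
     program have constant size, so this is unit cost up to a constant. *)

Inductive wexp : Type :=
| WConst of nat
| WSize                        (* the number n of points *)
| WGet of nat & wexp           (* array name, index *)
| WAdd of wexp & wexp
| WSub of wexp & wexp          (* truncated at 0 *)
| WMul of wexp & wexp
| WDiv of wexp & wexp
| WMod of wexp & wexp.

Inductive rexp : Type :=
| RDist of wexp & wexp
| RGet of nat & wexp.

Inductive bexp : Type :=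
| BWLt of wexp & wexp
| BRLt of rexp & rexp
| BNot of bexp
| BAnd of bexp & bexp.

Inductive cmd : Type :=
| CSkip
| CSet of nat & wexp & wexp    (* CSet a x e: a[x] := e *)
| CSetR of nat & wexp & rexp
| CRand of nat & wexp & wexp   (* CRand a x m: a[x] := uniform in {0, ..., m-1} *)
| CEmit of wexp & wexp         (* output a directed edge *)
| CSeq of cmd & cmd
| CIf of bexp & cmd & cmd
| CWhile of bexp & cmd.

Record state (R : realType) : Type := State {
  words : nat -> nat -> nat;
  reals : nat -> nat -> R;
  output : seq (nat * nat)
}.

Definition init_state (R : realType) : state R :=
  State (fun _ _ => 0%N) (fun _ _ => 0) [::].

Definition upd (T : Type) (m : nat -> nat -> T) (a x : nat) (v : T)
  : nat -> nat -> T :=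
  fun b y => if (b == a) && (y == x) then v else m b y.

Definition word_modulus (c n : nat) : nat := (2 ^ (c * (trunc_log 2 n).+1))%N.

Fixpoint weval (R : realType) (c n : nat) (s : state R) (e : wexp) : nat :=
  (match e with
   | WConst m => m
   | WSize => n
   | WGet a x => words s a (weval c n s x)
   | WAdd x y => weval c n s x + weval c n s y
   | WSub x y => weval c n s x - weval c n s y
   | WMul x y => weval c n s x * weval c n s y
   | WDiv x y => weval c n s x %/ weval c n s y
   | WMod x y => weval c n s x %% weval c n s y
   end %% word_modulus c n)%N.

Definition reval (R : realType) (c n : nat) (d : 'I_n -> 'I_n -> R)
    (s : state R) (e : rexp) : R :=
  match e with
  | RDist x y =>
      match insub (weval c n s x), insub (weval c n s y) with
      | Some i, Some j => d i j
      | _, _ => 0              (* not a pair of points *)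
      end
  | RGet a x => reals s a (weval c n s x)
  end.

Fixpoint beval (R : realType) (c n : nat) (d : 'I_n -> 'I_n -> R)
    (s : state R) (b : bexp) : bool :=
  match b with
  | BWLt x y => (weval c n s x < weval c n s y)%N
  | BRLt x y => reval c d s x < reval c d s y
  | BNot b1 => ~~ beval c d s b1
  | BAnd b1 b2 => beval c d s b1 && beval c d s b2
  end.

(* A configuration is the stack of commands still to be run and the state. *)
Definition config (R : realType) : Type := (seq cmd * state R)%type.

Definition halted (R : realType) (cf : config R) : bool := nilp cf.1.

(* The successors of a configuration, each taken with the same probability;
   only [CRand] has several.  [CRand] with bound 0 writes 0. *)
Definition step (R : realType) (c n : nat) (d : 'I_n -> 'I_n -> R)
    (cf : config R) : seq (config R) :=
  let: (k, s) := cf in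
  match k with
  | [::] => [::]
  | CSkip :: k => [:: (k, s)]
  | CSet a x e :: k =>
      [:: (k, State (upd (words s) a (weval c n s x) (weval c n s e))
                    (reals s) (output s))]
  | CSetR a x e :: k =>
      [:: (k, State (words s) (upd (reals s) a (weval c n s x) (reval c d s e))
                    (output s))]
  | CRand a x m :: k =>
      [seq (k, State (upd (words s) a (weval c n s x) v) (reals s) (output s))
      | v <- iota 0 (maxn 1 (weval c n s m))]
  | CEmit x y :: k =>
      [:: (k, State (words s) (reals s)
                    ((weval c n s x, weval c n s y) :: output s))]
  | CSeq c1 c2 :: k => [:: (c1 :: c2 :: k, s)]
  | CIf b c1 c2 :: k => [:: ((if beval c d s b then c1 else c2) :: k, s)]
  | CWhile b c1 :: k =>
      [:: (if beval c d s b then c1 :: CWhile b c1 :: k else k, s)]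
  end.

(* Every execution from [cf] halts in at most [t] steps. *)
Fixpoint halts_within (R : realType) (c n : nat) (d : 'I_n -> 'I_n -> R)
    (t : nat) (cf : config R) : bool :=
  halted cf ||
  (if t is t'.+1 then all (halts_within c d t') (step c d cf) else false).

(* Probability that the execution from [cf] halts in at most [t] steps in a
   state satisfying [Q]. *)
Fixpoint prob_within (R : realType) (c n : nat) (d : 'I_n -> 'I_n -> R)
    (t : nat) (Q : state R -> bool) (cf : config R) : R :=
  if halted cf then (Q cf.2)%:R
  else if t is t'.+1 then
    (\sum_(cf' <- step c d cf) prob_within c d t' Q cf')
      / (size (step c d cf))%:R
  else 0.

Definition output_graph (R : realType) (n : nat) (s : state R)
  : {set 'I_n * 'I_n} :=
  [set e : 'I_n * 'I_n | (val e.1, val e.2) \in output s].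

Definition runs_within (R : realType) (P : cmd) (c n : nat)
    (d : 'I_n -> 'I_n -> R) (t : nat) : bool :=
  halts_within c d t ([:: P], init_state R).

Definition prob_returns (R : realType) (P : cmd) (c n : nat)
    (d : 'I_n -> 'I_n -> R) (t : nat) (Q : {set 'I_n * 'I_n} -> bool) : R :=
  prob_within c d t (fun s => Q (output_graph n s)) ([:: P], init_state R).

(* Main.v *)
(** For a fixed point [i], the out-neighbourhoods allowed in a navigable graph
    are the covers of the points [j <> i], where [k] covers [j] if
    [d k j < d i j].  The algorithm computes a cover by playing a zero-sum game:
    every point [k] has a weight [u_k], initially 1, and [W] points are still
    uncovered.  As long as [W > 0] and the total weight [U] is below [n ^ 5], it
    draws an uncovered [j] uniformly and a point [k] with probability [u_k / U],
    adds the edge [(i, k)], and doubles the weights of all points covering [j].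

    If [m] is the total weight of the pairs (k covers j), then the expected
    values of [U] and [W] after the round are [U + m / W] and [W - m / U]; they
    are independent, so [U * W] does not increase in expectation.  It starts at
    [n (n - 1)], hence the loop stops with [U >= n ^ 5] and [W > 0] with
    probability at most [1 / n ^ 3].

    Each round doubles the weight of a member of an optimal cover, whatever the
    random choices.  Since these weights are at most [U < n ^ 5], there are at
    most [5 OPT_i log n] rounds, each of linear time: running time and
    out-degrees are bounded deterministically, and only navigability is
    random.

    For [OPT = O~(n^1.5)]: join [i] to [j] if fewer than [q ~ sqrt n] points are
    closer to [j] than [i], and join all points to a set of [O(q log n)] points
    hitting all larger such neighbourhoods. *)

Require Import Defs.
From mathcomp Require Import all_boot all_order all_algebra.
From mathcomp Require Import reals exp.
From mathcomp Require Import zify ring lra.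

Set Implicit Arguments.
Unset Strict Implicit.
Unset Printing Implicit Defensive.

Import Order.TTheory GRing.Theory Num.Theory.
Local Open Scope ring_scope.

(** * Programs with running time and success probability *)

Section Execution.

Variables (R : realType) (c n : nat) (d : 'I_n -> 'I_n -> R).
Implicit Types (s : state R) (k : seq cmd) (cf : config R) (Q : state R -> bool).

(** Once every execution has halted, extra time changes nothing, so time bounds can be rounded up
    freely without affecting probabilities. *)
Lemma halts_within_leq t t' Q cf :
  (t <= t')%N -> halts_within c d t cf ->
  halts_within c d t' cf /\ prob_within c d t' Q cf = prob_within c d t Q cf.
Proof.
elim: t t' cf => [|t IH] [|t'] cf // tt' /=.
- by case: (halted cf).
- case: (halted cf) => //=.
  suff K (l : seq (config R)) : all (halts_within c d t) l ->
      all (halts_within c d t') l /\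
      \sum_(cf' <- l) prob_within c d t' Q cf' = \sum_(cf' <- l) prob_within c d t Q cf'.
    by move=> /K[-> ->].
  elim: l => [|cf' l IHl] /=; first by rewrite !big_nil.
  by case/andP=> /(IH _ _ tt')[-> e] /IHl[-> el]; rewrite !big_cons e el.
Qed.

Definition returns (T : nat) (Q : state R -> bool) (p : R) cf : Prop :=
  halts_within c d T cf /\ p <= prob_within c d T Q cf.

Lemma returns_leq T T' Q p cf :
  (T <= T')%N -> returns T Q p cf -> returns T' Q p cf.
Proof.
by move=> TT' [hT pT]; have [? e] := halts_within_leq Q TT' hT; split; rewrite ?e.
Qed.

Lemma returns_halted T Q p s :
  p <= (Q s)%:R -> returns T Q p ([::], s).
Proof. by case: T => [|T] pQ; split. Qed.

Lemma returns_step T Q p cf cf' :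
  ~~ halted cf -> step c d cf = [:: cf'] ->
  returns T Q p cf' -> returns T.+1 Q p cf.
Proof.
move=> h e [hT pT]; split; rewrite /= e /=; first by rewrite hT orbT.
by rewrite (negPf h) big_seq1 divr1.
Qed.

(** The only rule that trades probabilities: the guarantee [f v] may depend on the drawn value, and
    [p] has to stay below the average of [f]. All other rules pass [p] on unchanged. *)
Lemma returns_rand T Q p (f : nat -> R) a x e k s (m := weval c n s e) :
  (0 < m)%N ->
  (forall v, (v < m)%N -> returns T Q (f v)
     (k, State (upd (words s) a (weval c n s x) v) (reals s) (output s))) ->
  p <= (\sum_(v < m) f v) / m%:R ->
  returns T.+1 Q p (CRand a x e :: k, s).
Proof.
move=> m0 H pf; have em : maxn 1 m = m by apply/maxn_idPr.
split; rewrite /= -/m em.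
  rewrite all_map; apply/allP => v /=.
  by rewrite mem_iota => /= vm; case: (H v vm).
apply: le_trans pf _; rewrite size_map size_iota big_map -val_enum_ord big_map big_enum /=.
by rewrite ler_wpM2r ?invr_ge0 ?ler0n // ler_sum // => v _; case: (H v).
Qed.

(* A Hoare triple with running time, in continuation-passing form so that it
   composes with the lower bounds on probabilities in [returns]. *)
Definition triple (t : nat) s (cm : cmd) (Post : state R -> Prop) : Prop :=
  forall T Q p k, (forall s', Post s' -> returns T Q p (k, s')) ->
  returns (t + T) Q p (cm :: k, s).

Lemma triple_conseq t t' s cm (Post Post' : state R -> Prop) :
  (t <= t')%N -> (forall s', Post s' -> Post' s') ->
  triple t s cm Post -> triple t' s cm Post'.
Proof.
move=> tt' PP H T Q p k HP; apply: (@returns_leq (t + T)); first by rewrite leq_add2r.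
by apply: H => s' /PP /HP.
Qed.

Lemma triple_skip s (Post : state R -> Prop) : Post s -> triple 1 s CSkip Post.
Proof. by move=> Ps T Q p k /(_ _ Ps); apply: returns_step. Qed.

Lemma triple_set s a x e (Post : state R -> Prop) :
  Post (State (upd (words s) a (weval c n s x) (weval c n s e)) (reals s) (output s)) ->
  triple 1 s (CSet a x e) Post.
Proof. by move=> Ps T Q p k /(_ _ Ps); apply: returns_step. Qed.

Lemma triple_seq t1 t2 s c1 c2 (Mid Post : state R -> Prop) :
  triple t1 s c1 Mid -> (forall s', Mid s' -> triple t2 s' c2 Post) ->
  triple (t1 + t2).+1 s (CSeq c1 c2) Post.
Proof.
move=> H1 H2 T Q p k HP; rewrite addSn -addnA.
apply: returns_step; [by []|by []|].
by apply: H1 => s' /H2; apply.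
Qed.

Lemma triple_if t s b c1 c2 (Post : state R -> Prop) :
  (beval c d s b -> triple t s c1 Post) ->
  (~~ beval c d s b -> triple t s c2 Post) ->
  triple t.+1 s (CIf b c1 c2) Post.
Proof.
move=> H1 H2 T Q p k HP; rewrite addSn; apply: returns_step; [by []|by []|].
by case: ifP => [/H1|/negbT/H2]; apply.
Qed.

(* [Inv m] is the invariant when at most [m] more rounds can follow. *)
Lemma triple_while t s b c1 (Inv : nat -> state R -> Prop) (Post : state R -> Prop) m :
  (forall m s, Inv m s -> beval c d s b ->
     exists2 m', (m' < m)%N & triple t s c1 (Inv m')) ->
  (forall m s, Inv m s -> ~~ beval c d s b -> Post s) ->
  Inv m s ->
  triple (m * t.+2).+1 s (CWhile b c1) Post.
Proof.
move=> Hb He; elim/ltn_ind: m s => m IH s Is T Q p k HP; rewrite addSn.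
apply: returns_step; [by []|by []|].
case: ifP => [bs|/negbT nb]; last first.
  by apply: (@returns_leq T); [exact: leq_addl|apply: HP; apply: He Is nb].
have [m' m'm Ht] := Hb _ _ Is bs.
apply: (@returns_leq (t + ((m' * t.+2).+1 + T))).
  have : (m'.+1 * t.+2 <= m * t.+2)%N by rewrite leq_mul2r m'm orbT.
  by rewrite mulSn; lia.
by apply: Ht => s' Is'; apply: IH Is' _ _ _ _ HP.
Qed.

End Execution.

(** * Optimal navigable graphs *)

Section Optima.

Variables (R : realType) (n : nat) (d : 'I_n -> 'I_n -> R).
Hypothesis dist_d : distance d.

Lemma navigableP (E : {set 'I_n * 'I_n}) :
  reflect (forall i j, i != j -> exists2 k, k \in outnbr E i & d k j < d i j)
          (navigable d E).
Proof.
apply: (iffP forallP) => [H i j ij|H i].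
  have /forallP/(_ j)/implyP/(_ ij)/existsP[k /andP[ik kj]] := H i.
  by exists k; rewrite ?inE.
apply/forallP => j; apply/implyP => /H[k]; rewrite inE => ik kj.
by apply/existsP; exists k; rewrite ik.
Qed.

Lemma card_edges (E : {set 'I_n * 'I_n}) : #|E| = (\sum_i #|outnbr E i|)%N.
Proof.
rewrite -sum1_card.
rewrite (eq_bigl (fun e : 'I_n * 'I_n => (true && ((e.1, e.2) \in E)))); last by case.
rewrite -(pair_big_dep predT (fun i k => (i, k) \in E) (fun _ _ => 1%N)) /=.
by apply: eq_bigr => i _; rewrite -sum1_card; apply: eq_bigl => k; rewrite inE.
Qed.

Lemma OPT_le (E : {set 'I_n * 'I_n}) : navigable d E -> (OPT d <= #|E|)%N.
Proof.
by rewrite /OPT; case: arg_minnP; [exact: navigable_setT|move=> E' _ H /H].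
Qed.

(** A single optimal graph is a candidate in each of the minima [OPTi], and its out-degrees add up
    to [OPT]. *)
Lemma sum_OPTi_le : (\sum_i OPTi d i <= OPT d)%N.
Proof.
rewrite /OPT; case: arg_minnP; first exact: navigable_setT.
move=> E nE _; rewrite card_edges; apply: leq_sum => i _.
by rewrite /OPTi; case: arg_minnP; [exact: navigable_setT|move=> E' _ /(_ _ nE)].
Qed.

(** [C] is the optimal cover against which the rounds are charged; it occurs only in the analysis,
    never in the program. *)
Lemma OPTi_cover i : exists2 C : {set 'I_n}, #|C| = OPTi d i &
  forall j, i != j -> exists2 k, k \in C & d k j < d i j.
Proof.
rewrite /OPTi; case: arg_minnP; first exact: navigable_setT.
by move=> E /navigableP nE _; exists (outnbr E i) => // j; apply: nE.
Qed.

Lemma OPTi_gt0 i : (1 < n)%N -> (0 < OPTi d i)%N.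
Proof.
move=> n1; have [C <- hC] := OPTi_cover i.
have [j ij] : exists j, i != j.
  case: (eqVneq i (Ordinal (ltnW n1))) => [->|]; last by exists (Ordinal (ltnW n1)).
  by exists (Ordinal n1).
by have [k kC _] := hC j ij; apply/card_gt0P; exists k.
Qed.

End Optima.

(** * Hitting sets and the bound of order [n ^ 1.5] on [OPT], up to logarithms *)

Lemma hitting_set (I : finType) (P : pred I) (n q s : nat) (D : I -> {set 'I_n}) :
  (forall x, P x -> (q <= #|D x|)%N) -> (#|I| * (n - q) ^ s < n ^ s)%N ->
  exists2 S : {set 'I_n}, (#|S| <= s)%N &
    forall x, P x -> exists2 k, k \in S & k \in D x.
Proof.
move=> qD small.
(* Probabilistic method by counting: [f] is a sample of [s] points with repetition, and [bad x]
   contains the samples that miss [D x], at most [(n - q) ^ s] of them when [P x] holds. By the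
   union bound some sample is in no such [bad x]; its image is [S]. *)
pose bad x := [set f : {ffun 'I_s -> 'I_n} | f \in ffun_on (mem (~: D x))].
case: (pickP (fun f => f \notin \bigcup_(x | P x) bad x)) => [f fP|H].
  exists [set f l | l in 'I_s].
    by apply: leq_trans (leq_imset_card _ _) _; rewrite card_ord.
  move=> x Px; have : f \notin bad x.
    by apply: contra fP => fx; apply/bigcupP; exists x.
  rewrite inE => /ffun_onP fD.
  case: (pickP (fun l => f l \in D x)) => [l lD|H].
    by exists (f l); first exact: imset_f.
  by case: fD => l; rewrite !inE H.
move: small; rewrite ltnNge => /negP[].
have <- : #|{ffun 'I_s -> 'I_n}| = (n ^ s)%N by rewrite card_ffun !card_ord.
have -> : #|{ffun 'I_s -> 'I_n}| = #|\bigcup_(x | P x) bad x|.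
  by apply: eq_card => f; have := H f; rewrite inE => /negbFE ->.
apply: (@leq_trans (\sum_(x | P x) #|bad x|)).
  elim/big_rec2: _ => [|x A m _ H']; first by rewrite cards0.
  by apply: leq_trans (leq_card_setU _ _) _; rewrite leq_add2l.
apply: (@leq_trans (\sum_(x | P x) (n - q) ^ s)).
  apply: leq_sum => x /qD qx; rewrite cardsE card_ffun_on card_ord.
  case: (posnP s) => [->|s0]; first by rewrite !expn0.
  rewrite leq_exp2r //; apply: leq_trans (leq_sub2l n qx).
  by rewrite -[X in (_ <= X - _)%N](card_ord n) -(cardsC (D x)) addKn.
by rewrite sum_nat_const leq_mul2r max_card orbT.
Qed.

(** Bernoulli's inequality for [(1 + b / a) ^ m], with denominators cleared. *)
Lemma bernoulli_nat a b m : (a ^ m * (a + m * b) <= (a + b) ^ m * a)%N.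
Proof.
elim: m => [|m IH]; first by rewrite !expn0 mul0n addn0.
rewrite !expnS -[X in (_ <= X)%N]mulnA.
apply: leq_trans (leq_mul (leqnn (a + b)) IH).
have -> : ((a + b) * (a ^ m * (a + m * b)) =
    a * a ^ m * (a + m.+1 * b) + a ^ m * (m * b * b))%N by ring.
exact: leq_addr.
Qed.

(** For [q < n], Bernoulli gives [(n / (n - q)) ^ q >= 1 + q ^ 2 / (n - q) >= 2]. *)
Lemma double_expn_sub n q : (0 < n)%N -> (n <= q * q)%N ->
  (2 * (n - q) ^ q <= n ^ q)%N.
Proof.
move=> n0 nq; case: (leqP n q) => [nq'|qn].
  rewrite (eqP nq') exp0n ?muln0 //; lia.
have := bernoulli_nat (n - q) q q; rewrite subnK ?(ltnW qn) // => H.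
have a0 : (0 < n - q)%N by lia.
rewrite -(leq_pmul2r a0); apply: leq_trans H.
by rewrite mulnAC mulnC leq_mul2l; apply/orP; right; lia.
Qed.

(** Each block of [q] samples at least halves the chance of missing a set of size [q], so [2 L]
    blocks bring it below [1 / n ^ 2], enough for a union bound over all [n ^ 2] pairs. *)
Lemma hitting_set_size n q L : (0 < n)%N -> (n <= q * q)%N -> (n < 2 ^ L)%N ->
  (n * n * (n - q) ^ (q * L.*2) < n ^ (q * L.*2))%N.
Proof.
move=> n0 nq nL; have H := double_expn_sub n0 nq.
have L0 : (0 < L.*2)%N by case: L nL {H} => //; rewrite expn0; lia.
rewrite !expnM; case: (posnP ((n - q) ^ q)) => [->|a0].
  by rewrite exp0n // muln0 -expnM expn_gt0 n0.
apply: (@leq_trans ((2 * (n - q) ^ q) ^ L.*2)); last by rewrite leq_exp2r.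
rewrite expnMn ltn_pmul2r; last by rewrite expn_gt0 a0.
by rewrite -addnn expnD ltn_mul.
Qed.

Lemma sqrt_ceil n : (0 < n)%N -> exists2 q, (n <= q * q)%N & (q * q <= 4 * n)%N.
Proof.
elim: n => // -[_ _|n IH _]; first by exists 1%N.
have [q q1 q2] := IH isT; case: (leqP n.+2 (q * q)) => [?|?].
  by exists q; lia.
by exists q.+1; nia.
Qed.

Lemma OPT_upper (R : realType) (n : nat) (d : 'I_n -> 'I_n -> R) q L :
  distance d -> general_position d ->
  (0 < n)%N -> (n <= q * q)%N -> (n < 2 ^ L)%N ->
  (OPT d <= 3 * n * q * L)%N.
Proof.
move=> dist_d gen_d n0 nq nL.
have L0 : (0 < L)%N by case: L nL => //; rewrite expn0; lia.
have q0 : (0 < q)%N by nia.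
(* [D (i, j)] consists of the points that may serve [i] as a first hop towards [j]. *)
pose D (x : 'I_n * 'I_n) := [set l | d l x.2 < d x.1 x.2].
have [|S cS hS] := @hitting_set _ (fun x => (q <= #|D x|)%N) n q (q * L.*2) D (fun x => id).
  by rewrite card_prod !card_ord; apply: hitting_set_size.
pose near := [set x : 'I_n * 'I_n | (#|D x| < q)%N].
pose E := near :|: setX setT S.
have nE : navigable d E.
  apply/navigableP => i j ij; case: (ltnP #|D (i, j)| q) => [lt|/hS[k kS]].
    exists j; first by rewrite !inE lt.
    by rewrite dist_d.1; have [] := dist_d.2 _ _ ij.
  by rewrite inE => kj; exists k; rewrite ?inE ?kS ?orbT.
apply: leq_trans (OPT_le dist_d nE) _.
have cnear : (#|near| <= n * q)%N.
  (* For fixed [j] the sets [D (i, j)] are nested by the distance of [i] to [j]. General position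
     makes these distances distinct and the inclusions strict, so at most one [i] has a given
     [#|D (i, j)|], and at most [q] pairs are near for each [j]. *)
  have inj : {in near &, injective (fun x => (x.2, inord #|D x|) : 'I_n * 'I_q.-1.+1)}.
    case=> [i j] [i' j']; rewrite !inE /= => lt + [ej].
    rewrite -ej => lt' /(congr1 val).
    rewrite /= !inordK ?prednK // => e.
    case: (eqVneq i i') => [->//|ii'].
    have dd (a b : 'I_n) : d a b = d b a.
      by case: (eqVneq a b) => [->//|/dist_d.2[]].
    have sub a b : d a j < d b j -> (#|D (a, j)| < #|D (b, j)|)%N.
      move=> lab; apply: proper_card; apply/properP; split.
        by apply/subsetP => l; rewrite !inE /= => /lt_trans; apply.
      by exists a; rewrite !inE //= ltxx.
    have := gen_d j i i' ii'; rewrite !(dd j) neq_lt => /orP[] /sub; move: e => /=; lia.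
  rewrite -(card_in_imset inj); apply: leq_trans (max_card _) _.
  rewrite card_prod !card_ord.
  by rewrite prednK.
apply: leq_trans (leq_card_setU _ _) _.
rewrite cardsX cardsT card_ord.
apply: leq_trans (leq_add cnear (leq_mul (leqnn n) cS)) _.
by rewrite -muln2; nia.
Qed.

(** * The algorithm *)

(* [pick_index w n] turns a uniform [r] below [\sum_(l < n) w l] into an index
   [l] drawn with probability proportional to [w l]. *)
Fixpoint pick_index (w : nat -> nat) n r : nat :=
  if n is m.+1 then if (r < \sum_(l < m) w l)%N then pick_index w m r else m
  else 0%N.

Lemma pick_indexP (w : nat -> nat) n r : (r < \sum_(l < n) w l)%N ->
  [/\ (pick_index w n r < n)%N,
      (\sum_(l < pick_index w n r) w l <= r)%N
    & (r < \sum_(l < (pick_index w n r).+1) w l)%N].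
Proof.
elim: n => [|n IH]; first by rewrite big_ord0.
move=> rS /=; case: (ltnP r (\sum_(l < n) w l)) => [lt|le]; last by split.
by have [? ? ?] := IH lt; split=> //; lia.
Qed.

Lemma eq_pick_index (w w' : nat -> nat) n r : w =1 w' ->
  pick_index w n r = pick_index w' n r.
Proof.
move=> e; elim: n => //= n ->; congr (if _ then _ else _).
by congr (r < _)%N; apply: eq_bigr => x _; apply: e.
Qed.

(** Exactly [w l] values of [r] select [l], so a uniform [r] yields the [w]-weighted average. *)
Lemma sum_pick_index (f w : nat -> nat) n :
  (\sum_(r < \sum_(l < n) w l) f (pick_index w n r) = \sum_(l < n) w l * f l)%N.
Proof.
elim: n => [|n IH]; first by rewrite !big_ord0.
rewrite [RHS]big_ord_recr -{}IH [in LHS]big_ord_recr /=; set S := (\sum_(l < n) w l)%N.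
(* The range of [r] is split at [S]: below it the recursion applies, and the last [w n] values all
   select [n]. *)
rewrite -(big_mkord xpredT (fun r => f (if r < S then pick_index w n r else n)%N)).
rewrite (big_cat_nat (n := S)) ?leq_addr //=; congr addn.
  by rewrite big_mkord; apply: eq_bigr => r _; rewrite ltn_ord.
rewrite (eq_big_nat _ _ (F2 := fun _ => f n)) => [|r /andP[le _]]; last by rewrite ltnNge le.
by rewrite sum_nat_const_nat addKn.
Qed.

Lemma psumS (w : nat -> nat) m :
  (\sum_(l < m.+1) w l = \sum_(l < m) w l + w m)%N.
Proof. by rewrite big_ord_recr. Qed.

Lemma leq_psum (w : nat -> nat) a b : (a <= b)%N ->
  (\sum_(l < a) w l <= \sum_(l < b) w l)%N.
Proof.
move=> ab; rewrite -(subnKC ab); elim: (b - a)%N => [|m IH]; first by rewrite addn0.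
by rewrite addnS big_ord_recr /= (leq_trans IH) // leq_addr.
Qed.

Lemma leq_term_psum (w : nat -> nat) a b : (a < b)%N -> (w a <= \sum_(l < b) w l)%N.
Proof.
by move=> ab; apply: leq_trans (leq_psum w ab); rewrite big_ord_recr leq_addl.
Qed.

(* Word arrays: [vI] is the current point [i], [vL] a loop counter, [vJ] and [vK]
   the drawn points [j] and [k], [vR] the drawn number; [aU] holds the weights,
   [aW] flags the uncovered points, and [vU], [vW] are their sums. *)
Definition vI := 0%N.
Definition vL := 1%N.
Definition vU := 2%N.
Definition vW := 3%N.
Definition vR := 4%N.
Definition vJ := 5%N.
Definition vK := 6%N.
Definition aU := 7%N.
Definition aW := 8%N.

Local Notation "c1 ;; c2" := (CSeq c1 c2) (at level 60, right associativity).
Local Notation "$ v" := (WGet v (WConst 0)) (at level 1, format "$ v").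
Local Notation "v ::= e" := (CSet v (WConst 0) e) (at level 55).

Definition for_points (body : cmd) : cmd :=
  vL ::= WConst 0 ;;
  CWhile (BWLt $vL WSize) (body ;; vL ::= WAdd $vL (WConst 1)).

Definition search_cmd (a v : nat) : cmd :=
  v ::= WConst 0 ;;
  CWhile (BNot (BWLt $vR (WGet a $v)))
    (vR ::= WSub $vR (WGet a $v) ;; v ::= WAdd $v (WConst 1)).

Definition init_cmd : cmd :=
  for_points (CSet aU $vL (WConst 1) ;; CSet aW $vL (WConst 1)) ;;
  CSet aW $vI (WConst 0) ;;
  vU ::= WSize ;;
  vW ::= WSub WSize (WConst 1).

Definition update_cmd : cmd :=
  vU ::= WConst 0 ;;
  vW ::= WConst 0 ;;
  for_points
    (CIf (BRLt (RDist $vL $vJ) (RDist $vI $vJ))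
       (CSet aU $vL (WAdd (WGet aU $vL) (WGet aU $vL))) CSkip ;;
     CIf (BRLt (RDist $vK $vL) (RDist $vI $vL)) (CSet aW $vL (WConst 0)) CSkip ;;
     vU ::= WAdd $vU (WGet aU $vL) ;;
     vW ::= WAdd $vW (WGet aW $vL)).

Definition round_cmd : cmd :=
  CRand vR (WConst 0) $vW ;; search_cmd aW vJ ;;
  CRand vR (WConst 0) $vU ;; search_cmd aU vK ;;
  CEmit $vI $vK ;; update_cmd.

(** The exponent 5 is chosen for the final union bound: a potential starting at [n (n - 1)] reaches
    [n ^ 5] with probability at most [1 / n ^ 3], so the [n] points together fail with probability
    at most [1 / n ^ 2]. *)
Definition size_pow5 : wexp :=
  WMul WSize (WMul WSize (WMul WSize (WMul WSize WSize))).

Definition cover_cmd : cmd :=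
  CWhile (BAnd (BWLt (WConst 0) $vW) (BWLt $vU size_pow5)) round_cmd.

Definition build_cmd : cmd :=
  CWhile (BWLt $vI WSize) (init_cmd ;; cover_cmd ;; vI ::= WAdd $vI (WConst 1)).

(** * Overflow-free evaluation, the loop over points, and the weighted search *)

Section Commands.

Variables (R : realType) (n : nat) (d : 'I_n -> 'I_n -> R).
Hypothesis n_gt1 : (1 < n)%N.

Local Notation M := (word_modulus 7 n).
Local Notation eval := (weval 7 n).
Local Notation triple := (triple 7 d).
Local Notation returns := (returns 7 d).
Implicit Types (s : state R).

(** The word constant 7 leaves room for the largest numbers that occur, weight sums of up to
    [2 * n ^ 5]. *)
Lemma expn_lt_modulus : (n ^ 7 < M)%N.
Proof.
by rewrite /word_modulus mulnC expnM ltn_exp2r // trunc_log_ltn.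
Qed.

Lemma size_lt_modulus : (n < M)%N.
Proof.
by apply: leq_ltn_trans expn_lt_modulus; rewrite -{1}[n]expn1 leq_exp2l.
Qed.

Lemma modulus_gt1 : (1 < M)%N.
Proof. exact: ltn_trans n_gt1 size_lt_modulus. Qed.

Lemma pow5_lt_modulus : (2 * n ^ 5 < M)%N.
Proof.
apply: leq_ltn_trans expn_lt_modulus; rewrite -[7%N]/(2 + 5)%N expnD leq_mul2r -mulnn.
by apply/orP; right; nia.
Qed.

Lemma bevalLt s x y : beval 7 d s (BWLt x y) = (eval s x < eval s y)%N.
Proof. by []. Qed.

Lemma bevalN s b : beval 7 d s (BNot b) = ~~ beval 7 d s b.
Proof. by []. Qed.

Lemma bevalA s b b' : beval 7 d s (BAnd b b') = beval 7 d s b && beval 7 d s b'.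
Proof. by []. Qed.

Lemma weval0 s : eval s (WConst 0) = 0%N.
Proof. by rewrite /= mod0n. Qed.

Lemma weval1 s : eval s (WConst 1) = 1%N.
Proof. by rewrite /= modn_small ?modulus_gt1. Qed.

Lemma weval_size s : eval s WSize = n.
Proof. by rewrite /= modn_small ?size_lt_modulus. Qed.

Lemma weval_get s a x y : eval s x = y -> (words s a y < M)%N ->
  eval s (WGet a x) = words s a y.
Proof. by move=> /= -> lt; rewrite modn_small. Qed.

Lemma weval_var s a : (words s a 0%N < M)%N -> eval s $a = words s a 0%N.
Proof. by apply: weval_get; rewrite weval0. Qed.

Lemma weval_add s x y a b : eval s x = a -> eval s y = b -> (a + b < M)%N ->
  eval s (WAdd x y) = (a + b)%N.
Proof. by move=> /= -> -> lt; rewrite modn_small. Qed.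

Lemma weval_sub s x y a b : eval s x = a -> eval s y = b -> (a < M)%N ->
  eval s (WSub x y) = (a - b)%N.
Proof. by move=> /= -> -> lt; rewrite modn_small // (leq_ltn_trans _ lt) // leq_subr. Qed.

Lemma weval_mul s x y a b : eval s x = a -> eval s y = b -> (a * b < M)%N ->
  eval s (WMul x y) = (a * b)%N.
Proof. by move=> /= -> -> lt; rewrite modn_small. Qed.

Lemma weval_pow5 s : eval s size_pow5 = (n ^ 5)%N.
Proof.
have B m : (m <= 5)%N -> (n ^ m < M)%N.
  move=> m5; apply: leq_ltn_trans expn_lt_modulus; rewrite leq_exp2l //.
  by apply: leq_trans m5 _.
have E m e : (m < 5)%N -> eval s e = (n ^ m)%N -> eval s (WMul WSize e) = (n ^ m.+1)%N.
  move=> m5 ee; rewrite expnS; apply: weval_mul; rewrite ?weval_size // -expnS.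
  exact: B.
by do 4!apply: (E) => //; rewrite weval_size.
Qed.

(** A frame condition. It speaks of words and output only, because the program compares distances
    directly and never writes to [reals]. *)
Definition agree_off (l : seq nat) s s' : Prop :=
  output s' = output s /\ forall a x, a \notin l -> words s' a x = words s a x.

(** The counter is itself a word array, so the invariant must survive writes to [vL]; the [agree_off
    [:: vL]] clauses express this for the initial assignment and for the increment. *)
Lemma triple_for t body (Inv : nat -> state R -> Prop) (Post : state R -> Prop) s :
  (forall s', agree_off [:: vL] s s' -> words s' vL 0%N = 0%N -> Inv 0%N s') ->
  (forall m s', (m < n)%N -> words s' vL 0%N = m -> Inv m s' ->
     triple t s' body (fun s2 => words s2 vL 0%N = m /\
        forall s3, agree_off [:: vL] s2 s3 -> words s3 vL 0%N = m.+1 -> Inv m.+1 s3)) ->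
  (forall s', Inv n s' -> Post s') ->
  triple (n * (t + 4) + 3) s (for_points body) Post.
Proof.
move=> H0 Hb He; have nM := size_lt_modulus.
pose J m s' := exists l, [/\ words s' vL 0%N = l, (l + m)%N = n & Inv l s'].
apply: (@triple_conseq _ 7 n d (1 + (n * (t + 1).+1.+2).+1).+1 _ _ _ Post); [lia|by []|].
apply: (triple_seq (Mid := J n)).
  apply: triple_set; rewrite weval0; exists 0%N; split=> //.
  by apply: H0 => //=; split=> // a x; rewrite inE /= /upd => /negPf->.
move=> s1 J1; apply: (triple_while (Inv := J)) J1.
- move=> m s' [l [e lm Il]]; rewrite bevalLt weval_size weval_var e; last by lia.
  move=> ln; exists m.-1; first by lia.
  apply: triple_seq; first exact: Hb ln e Il.
  move=> s2 [e2 H2]; apply: triple_set; rewrite weval0.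
  rewrite (weval_add (a := l) (b := 1)) ?weval1 ?weval_var ?e2 //; try lia.
  rewrite addn1; exists l.+1; split; [by []|by lia|].
  by apply: H2 => //=; split=> // a x; rewrite inE /= /upd => /negPf->.
- move=> m s' [l [e lm Il]]; rewrite bevalLt weval_size weval_var e; last by lia.
  by rewrite -leqNgt => nl; apply: He; have -> : n = l by lia.
Qed.

(** The remainder in [vR] plus the weights already passed is always [r]. Hence the loop stops at the
    first index whose prefix sum, itself included, exceeds [r], and this is [pick_index w n r]. *)
Lemma triple_search s a v (w := words s a) (r := words s vR 0%N) :
  uniq [:: a; v; vR] ->
  (r < \sum_(l < n) w l)%N -> (\sum_(l < n) w l < M)%N ->
  triple (n * 5 + 3) s (search_cmd a v)
    (fun s' => words s' v 0%N = pick_index w n r /\ agree_off [:: v; vR] s s').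
Proof.
rewrite /= !inE !negb_or => /and3P[/andP[av aR] vr _] rS SM.
have [tn tr rt] := pick_indexP rS; set t := pick_index w n r in tn tr rt *.
have nM := size_lt_modulus.
pose J m s' := exists j, [/\ words s' v 0%N = j, (j + m)%N = t,
  (words s' vR 0%N + \sum_(l < j) w l)%N = r & agree_off [:: v; vR] s s'].
apply: (@triple_conseq _ 7 n d (1 + (t * (1 + 1).+1.+2).+1).+1); [by lia|by move=> s'; exact|].
apply: (triple_seq (Mid := J t)).
  apply: triple_set; rewrite weval0; exists 0%N; split=> //=.
  - by rewrite /upd !eqxx.
  - by rewrite /upd [_ == v]eq_sym (negPf vr) big_ord0 addn0.
  - split=> // b x; rewrite !inE /upd /= => /norP[/negPf-> _]; by [].
have ev s' j : words s' v 0%N = j -> (j < n)%N -> agree_off [:: v; vR] s s' ->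
    eval s' (WGet a $v) = w j.
  move=> e jn [_ ag]; have aw : words s' a j = w j by rewrite ag // !inE (negPf av) (negPf aR).
  rewrite (weval_get (y := j)) ?aw ?weval_var ?e //; try lia.
  by apply: leq_ltn_trans SM; apply: leq_term_psum.
move=> s1 J1; apply: (triple_while (Inv := J)) J1.
- move=> m s' [j [e jm er ag]]; have jn : (j < n)%N by lia.
  have rM : (words s' vR 0%N < M)%N by lia.
  rewrite bevalN bevalLt (ev _ j) // weval_var // -leqNgt => wr.
  have jt : (j < t)%N.
    rewrite ltn_neqAle; apply/andP; split; last by lia.
    by apply/eqP => jt; move: rt; rewrite -jt psumS -er addnC ltn_add2l ltnNge wr.
  exists m.-1; first by lia.
  apply: (triple_seq (Mid := fun s2 => [/\ words s2 v 0%N = j,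
    (words s2 vR 0%N + \sum_(l < j.+1) w l)%N = r & agree_off [:: v; vR] s s2])).
    apply: triple_set; rewrite weval0.
    rewrite (weval_sub (a := words s' vR 0%N) (b := w j)) ?weval_var ?(ev _ j) //.
    rewrite /upd /= (negPf vr) psumS; split=> //; first by lia.
    case: ag => o ag; split=> // b x; rewrite !inE /= => /norP[bv bR].
    by rewrite (negPf bR) /= ag // !inE (negPf bv).
  move=> s2 [e2 er2 ag2]; apply: triple_set; rewrite weval0.
  rewrite (weval_add (a := j) (b := 1)) ?weval1 ?weval_var ?e2 //; try lia.
  exists j.+1; split.
  - by rewrite /= /upd !eqxx addn1.
  - by lia.
  - by rewrite /= /upd [_ == v]eq_sym (negPf vr).
  - case: ag2 => o ag2; split=> // b x bn; rewrite /= -ag2 // /upd.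
    by move: bn; rewrite !inE => /norP[/negPf->].
- move=> m s' [j [e jm er ag]]; have jn : (j < n)%N by lia.
  have rM : (words s' vR 0%N < M)%N by lia.
  rewrite bevalN bevalLt (ev _ j) // weval_var // negbK => rw; split=> //; rewrite e.
  case: (posnP m) => [m0|m0]; first by lia.
  have : (\sum_(l < j.+1) w l <= \sum_(l < t) w l)%N by apply: leq_psum; lia.
  by rewrite psumS; lia.
Qed.

End Commands.

(** * Initialising the weights for a point and updating them in a round *)

Section Rounds.

Variables (R : realType) (n : nat) (d : 'I_n -> 'I_n -> R).
Hypothesis n_gt1 : (1 < n)%N.

Local Notation M := (word_modulus 7 n).
Local Notation eval := (weval 7 n).
Local Notation triple := (triple 7 d).
Implicit Types (s : state R).

Lemma agree_off_trans l l1 s s1 s2 : agree_off l s s1 -> agree_off l1 s1 s2 ->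
  {subset l1 <= l} -> agree_off l s s2.
Proof.
move=> [o a] [o1 a1] sub; split=> [|b x bl]; first by rewrite o1.
by rewrite a1 ?a //; apply: contra bl; apply: sub.
Qed.

Lemma agree_off_upd l s a x v : a \in l ->
  agree_off l s (State (upd (words s) a x v) (reals s) (output s)).
Proof.
move=> al; split=> // b y bl /=; rewrite /upd.
by case: eqP bl => // ->; rewrite al.
Qed.

(** Mirrors the evaluation of [RDist], default value included, so that weights and covering can be
    indexed by words instead of ordinals. *)
Definition dist_nat (x y : nat) : R :=
  match insub x : option 'I_n, insub y : option 'I_n with
  | Some i, Some j => d i j
  | _, _ => 0
  end.

Lemma dist_nat_ord (i j : 'I_n) : dist_nat i j = d i j.
Proof. by rewrite /dist_nat !valK. Qed.

Definition covers (i k j : nat) : bool := dist_nat k j < dist_nat i j.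

Lemma beval_covers s k i j x y z :
  eval s x = k -> eval s y = j -> eval s z = i ->
  beval 7 d s (BRLt (RDist x y) (RDist z y)) = covers i k j.
Proof. by move=> /= -> -> ->. Qed.

Definition double_covering (u : nat -> nat) i j x : nat :=
  if covers i x j then (u x + u x)%N else u x.

Definition zero_covered (w : nat -> nat) i k x : nat :=
  if covers i k x then 0%N else w x.

Lemma triple_init s (i : nat) : words s vI 0%N = i -> (i < n)%N ->
  triple (n * 7 + 9) s init_cmd (fun s' =>
    [/\ output s' = output s, words s' vI 0%N = i,
        (forall x, (x < n)%N -> words s' aU x = 1%N),
        (forall x, (x < n)%N -> words s' aW x = (x != i)) &
        words s' vU 0%N = n /\ words s' vW 0%N = n.-1]).
Proof.
move=> ei ilt; have nM := size_lt_modulus n_gt1.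
pose Inv m s' := [/\ output s' = output s, words s' vI 0%N = i,
  (forall x, (x < m)%N -> words s' aU x = 1%N) &
  (forall x, (x < m)%N -> words s' aW x = 1%N)].
apply: (@triple_conseq _ 7 n d ((n * (3 + 4) + 3) + (1 + (1 + 1).+1).+1).+1);
  [lia|by move=> s'; exact|].
apply: (triple_seq (Mid := Inv n)).
  apply: (triple_for n_gt1 (Inv := Inv)) => //.
    by move=> s' [o ag] _; split=> //; rewrite ?ag.
  move=> m s' mn em [o eI eU eW].
  have em' : eval s' $vL = m by rewrite weval_var ?em //; lia.
  apply: (triple_seq (t1 := 1) (t2 := 1) (Mid := fun s2 => [/\ output s2 = output s,
      words s2 vI 0%N = i, (forall x, (x < m.+1)%N -> words s2 aU x = 1%N),
      (forall x, (x < m)%N -> words s2 aW x = 1%N) & words s2 vL 0%N = m])).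
    apply: triple_set; rewrite em' weval1 //; split=> //= x; rewrite /upd //=.
    by case: eqP => //= xm xlt; apply: eU; lia.
  move=> s2 [o2 eI2 eU2 eW2 eL2]; apply: triple_set; rewrite weval1 // weval_var ?eL2; last by lia.
  split=> //= s3 [o3 ag] _; split; rewrite ?o3 ?ag // => x xlt; rewrite ag //= /upd /=.
    by apply: eU2.
  by case: eqP => //= xm; apply: eW2; lia.
move=> s1 [o1 eI1 eU1 eW1].
apply: (triple_seq (Mid := fun s2 => [/\ output s2 = output s, words s2 vI 0%N = i,
    (forall x, (x < n)%N -> words s2 aU x = 1%N) &
    (forall x, (x < n)%N -> words s2 aW x = (x != i))])).
  apply: triple_set; rewrite weval0 weval_var ?eI1; last by lia.
  split=> //= x xn; rewrite /upd /=.
  by case: eqP => //= _; apply: eW1.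
move=> s2 [o2 eI2 eU2 eW2].
apply: (triple_seq (Mid := fun s3 => [/\ output s3 = output s, words s3 vI 0%N = i,
    (forall x, (x < n)%N -> words s3 aU x = 1%N),
    (forall x, (x < n)%N -> words s3 aW x = (x != i)) & words s3 vU 0%N = n])).
  by apply: triple_set; rewrite weval0 weval_size.
move=> s3 [o3 eI3 eU3 eW3 en]; apply: triple_set; rewrite weval0.
by rewrite (weval_sub (a := n) (b := 1)) ?weval_size ?weval1 // subn1.
Qed.

Lemma sum_zero_covered (w : nat -> nat) i k m :
  (\sum_(x < m) zero_covered w i k x <= \sum_(x < m) w x)%N.
Proof. by apply: leq_sum => x _; rewrite /zero_covered; case: ifP. Qed.

Lemma sum_double_covering (u : nat -> nat) i j m :
  (\sum_(x < m) double_covering u i j x <= 2 * \sum_(x < m) u x)%N.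
Proof.
rewrite big_distrr /=; apply: leq_sum => x _; rewrite /double_covering mul2n -addnn.
by case: ifP => // _; rewrite leq_addl.
Qed.

Lemma triple_update s (i j k : nat) (u w : nat -> nat) :
  [/\ words s vI 0%N = i, words s vJ 0%N = j & words s vK 0%N = k] ->
  [/\ (i < n)%N, (j < n)%N & (k < n)%N] ->
  (forall x, words s aU x = u x) -> (forall x, words s aW x = w x) ->
  (2 * \sum_(x < n) u x < M)%N -> (\sum_(x < n) w x < M)%N ->
  triple (n * 13 + 7) s update_cmd (fun s' =>
    [/\ output s' = output s, words s' vI 0%N = i,
        (forall x, (x < n)%N -> words s' aU x = double_covering u i j x),
        (forall x, (x < n)%N -> words s' aW x = zero_covered w i k x) &
        words s' vU 0%N = (\sum_(x < n) double_covering u i j x)%N /\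
        words s' vW 0%N = (\sum_(x < n) zero_covered w i k x)%N]).
Proof.
move=> [eI eJ eK] [ilt jlt klt] eu ew uM wM; have nM := size_lt_modulus n_gt1.
pose u' := double_covering u i j; pose w' := zero_covered w i k.
pose l := [:: vL; vU; vW; aU; aW].
(* The four indices are the progress in [aU], [aW], [vU] and [vW]. They agree at the loop head, and
   the four commands of the body advance them one by one. *)
pose St a b p q s' := [/\ agree_off l s s',
  (forall x, words s' aU x = if (x < a)%N then u' x else u x),
  (forall x, words s' aW x = if (x < b)%N then w' x else w x),
  words s' vU 0%N = (\sum_(x < p) u' x)%N & words s' vW 0%N = (\sum_(x < q) w' x)%N].
pose Inv m s' := St m m m m s'.
have u'M m : (m <= n)%N -> (\sum_(x < m) u' x < M)%N.
  move=> /(leq_psum u') h.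
  by apply: leq_ltn_trans h (leq_ltn_trans (sum_double_covering _ _ _ _) uM).
have w'M m : (m <= n)%N -> (\sum_(x < m) w' x < M)%N.
  move=> /(leq_psum w') h.
  by apply: leq_ltn_trans h (leq_ltn_trans (sum_zero_covered _ _ _ _) wM).
have fixd s' a : agree_off l s s' -> a \notin l -> words s' a 0%N = words s a 0%N.
  by move=> [_ ag] al; apply: ag.
have evI s' : agree_off l s s' -> eval s' $vI = i.
  by move=> /fixd e; rewrite weval_var e ?eI //; lia.
have evJ s' : agree_off l s s' -> eval s' $vJ = j.
  by move=> /fixd e; rewrite weval_var e ?eJ //; lia.
have evK s' : agree_off l s s' -> eval s' $vK = k.
  by move=> /fixd e; rewrite weval_var e ?eK //; lia.
have ltS a b : (a < b.+1)%N = (a == b) || (a < b)%N by rewrite ltnS leq_eqVlt.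
apply: (@triple_conseq _ 7 n d (1 + (1 + (n * (9 + 4) + 3)).+1).+1); [lia|by move=> s'; exact|].
apply: (triple_seq (Mid := fun s1 => [/\ agree_off l s s1,
  forall x, words s1 aU x = u x, forall x, words s1 aW x = w x & words s1 vU 0%N = 0%N])).
  by apply: triple_set; rewrite !weval0; split=> //; apply: agree_off_upd.
move=> s1 [ag1 eu1 ew1 e1].
apply: (triple_seq (Mid := Inv 0%N)).
  apply: triple_set; rewrite !weval0; split; rewrite ?big_ord0 //.
  by apply: agree_off_trans ag1 _ (fun _ => id); apply: agree_off_upd.
move=> s2 [ag2 eu2 ew2 eU2 eW2].
have St_agree a b p q s3 s4 : agree_off [:: vL] s3 s4 -> St a b p q s3 -> St a b p q s4.
  move=> ag [ag3 eu3 ew3 eU3 eW3]; split.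
  - by apply: agree_off_trans ag3 ag _ => x; rewrite !inE => ->.
  - by move=> x; rewrite ag.2.
  - by move=> x; rewrite ag.2.
  - by rewrite ag.2.
  - by rewrite ag.2.
apply: (triple_for n_gt1 (Inv := Inv)) => [s3 ag _|m s3 mn eL S3|s3].
- exact: St_agree ag _.
- have evL s4 : words s4 vL 0%N = m -> eval s4 $vL = m.
    by move=> e; rewrite weval_var e //; lia.
  apply: (triple_seq (t1 := 2) (t2 := 6)
      (Mid := fun s4 => words s4 vL 0%N = m /\ St m.+1 m m m s4)).
    have [ag3 eu3 ew3 eU3 eW3] := S3.
    have eum : words s3 aU m = u m by rewrite eu3 ltnn.
    have um : (u m + u m < M)%N.
      by apply: leq_ltn_trans uM; rewrite addnn -mul2n leq_mul2l leq_term_psum.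
    apply: triple_if; rewrite (beval_covers (k := m) (i := i) (j := j)) ?evL ?evI ?evJ // => cov.
      apply: triple_set; rewrite evL // (weval_add (a := u m) (b := u m)) //;
        try by rewrite (weval_get (y := m)) ?evL ?eum //; lia.
      split=> //; split=> //=.
      + by apply: agree_off_trans ag3 _ (fun _ => id); apply: agree_off_upd.
      + move=> x; rewrite /upd /= eu3 ltS; case: eqP => // ->.
        by rewrite /u' /double_covering cov.
    apply: triple_skip; split=> //; split=> // x; rewrite eu3 ltS.
    by case: eqP => // ->; rewrite ltnn /u' /double_covering (negPf cov).
  move=> {s3 eL S3} s3 [eL S3].
  apply: (triple_seq (t1 := 2) (t2 := 3)
      (Mid := fun s4 => words s4 vL 0%N = m /\ St m.+1 m.+1 m m s4)).
    have [ag3 eu3 ew3 eU3 eW3] := S3.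
    apply: triple_if; rewrite (beval_covers (k := k) (i := i) (j := m)) ?evL ?evI ?evK // => cov.
      apply: triple_set; rewrite evL // weval0; split=> //; split=> //=.
      + by apply: agree_off_trans ag3 _ (fun _ => id); apply: agree_off_upd.
      + move=> x; rewrite /upd /= ew3 ltS; case: eqP => // ->.
        by rewrite /w' /zero_covered cov.
    apply: triple_skip; split=> //; split=> // x; rewrite ew3 ltS.
    by case: eqP => // ->; rewrite ltnn /w' /zero_covered (negPf cov).
  move=> {s3 eL S3} s3 [eL S3].
  apply: (triple_seq (t1 := 1) (t2 := 1)
      (Mid := fun s4 => words s4 vL 0%N = m /\ St m.+1 m.+1 m.+1 m s4)).
    have [ag3 eu3 ew3 eU3 eW3] := S3.
    have eum : words s3 aU m = u' m by rewrite eu3 ltnSn.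
    have um := u'M m.+1 mn; rewrite psumS in um.
    apply: triple_set; rewrite weval0.
    rewrite (weval_add (a := \sum_(x < m) u' x) (b := u' m)) //.
    + split=> //; split=> //=.
      * by apply: agree_off_trans ag3 _ (fun _ => id); apply: agree_off_upd.
      * by rewrite /upd /= psumS.
    + by rewrite weval_var ?eU3 //; lia.
    + by rewrite (weval_get (y := m)) ?evL ?eum //; lia.
  move=> {s3 eL S3} s3 [eL S3].
  have [ag3 eu3 ew3 eU3 eW3] := S3.
  have ewm : words s3 aW m = w' m by rewrite ew3 ltnSn.
  have wm := w'M m.+1 mn; rewrite psumS in wm.
  apply: triple_set; rewrite weval0.
  rewrite (weval_add (a := \sum_(x < m) w' x) (b := w' m)) //.
  + split=> // s4 ag4 _; apply: St_agree ag4 _; split=> //=.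
    * by apply: agree_off_trans ag3 _ (fun _ => id); apply: agree_off_upd.
    * by rewrite /upd /= psumS.
  + by rewrite weval_var ?eW3 //; lia.
  + by rewrite (weval_get (y := m)) ?evL ?ewm //; lia.
- move=> [ag3 eu3 ew3 eU3 eW3]; split=> //.
  + by case: ag3.
  + by rewrite (fixd _ vI ag3).
  + by move=> x xn; rewrite eu3 xn.
  + by move=> x xn; rewrite ew3 xn.
Qed.

End Rounds.

(** * The potential [U * W] *)

Section RoundAnalysis.

Variables (R : realType) (n : nat) (d : 'I_n -> 'I_n -> R).
Hypothesis n_gt1 : (1 < n)%N.

Local Notation M := (word_modulus 7 n).
Local Notation returns := (returns 7 d).
Local Notation covers := (covers d).
Local Notation double_covering := (double_covering d).
Local Notation zero_covered := (zero_covered d).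
Implicit Types (s : state R).

Lemma returns_seq T Q p c1 c2 k s :
  returns T Q p (c1 :: c2 :: k, s) -> returns T.+1 Q p (CSeq c1 c2 :: k, s).
Proof. exact: returns_step. Qed.

Definition after_round s i j k s' : Prop :=
  [/\ output s' = (i, k) :: output s, words s' vI 0%N = i,
      (forall x, (x < n)%N -> words s' aU x = double_covering (words s aU) i j x),
      (forall x, (x < n)%N -> words s' aW x = zero_covered (words s aW) i k x) &
      words s' vU 0%N = (\sum_(x < n) double_covering (words s aU) i j x)%N /\
      words s' vW 0%N = (\sum_(x < n) zero_covered (words s aW) i k x)%N].

(** [pf j l] is the guarantee after the draws [j] and [l], and the two nested averages come from the
    two uses of [CRand]. The condition [0 < w j] records that only uncovered points are drawn. *)
Lemma returns_round T Q k s i p (pf : nat -> nat -> R)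
    (u := words s aU) (w := words s aW)
    (U := (\sum_(x < n) u x)%N) (W := (\sum_(x < n) w x)%N) :
  words s vI 0%N = i -> (i < n)%N ->
  words s vU 0%N = U -> words s vW 0%N = W ->
  (0 < U)%N -> (2 * U < M)%N -> (0 < W < M)%N ->
  (forall j l s', (j < n)%N -> (l < n)%N -> (0 < w j)%N -> after_round s i j l s' ->
     returns T Q (pf j l) (k, s')) ->
  p <= (\sum_(r < W) ((\sum_(q < U) pf (pick_index w n r) (pick_index u n q)) / U%:R)) / W%:R ->
  returns (n * 23 + 21 + T) Q p (round_cmd :: k, s).
Proof.
move=> eI ilt eU eW U0 UM /andP[W0 WM] H Hp.
have nM := size_lt_modulus n_gt1.
have UM' : (U < M)%N by lia.
(* Two searches, the update, and eight single steps: five sequencings, two draws and one output. *)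
apply: (@returns_leq _ _ _ _ ((n * 5 + 3) + ((n * 5 + 3) + (1 + (n * 13 + 7) + T).+1).+3).+3);
  first by lia.
apply: returns_seq.
have evW : weval 7 n s $vW = W by rewrite weval_var ?eW.
apply: (returns_rand (f := fun r =>
  (\sum_(q < U) pf (pick_index w n r) (pick_index u n q)) / U%:R)); rewrite evW //.
move=> r rW; rewrite weval0; apply: returns_seq.
set s1 := State _ _ _.
apply: (@triple_search R n d n_gt1 s1 aW vJ) => // s2 [eJ [o2 ag2]].
have [jn jr rj] := pick_indexP rW; rewrite /s1 /= in eJ; set j := pick_index w n r in jn jr rj eJ *.
have wj : (0 < w j)%N by move: rj; rewrite psumS; lia.
have eU2 : words s2 vU 0%N = U by rewrite ag2.
have eu2 x : words s2 aU x = u x by rewrite ag2.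
have ew2 x : words s2 aW x = w x by rewrite ag2.
have eI2 : words s2 vI 0%N = i by rewrite ag2.
apply: returns_seq.
have evU : weval 7 n s2 $vU = U by rewrite weval_var ?eU2.
apply: (returns_rand (f := fun q => pf j (pick_index u n q))); rewrite evU //.
move=> q qU; rewrite weval0; apply: returns_seq.
set s3 := State _ _ _.
have sum3 : (\sum_(x < n) words s3 aU x = U)%N by apply: eq_bigr => x _; rewrite /s3 /= /upd eu2.
have pick3 : pick_index (words s3 aU) n q = pick_index u n q.
  by apply: eq_pick_index => x; rewrite /s3 /= /upd eu2.
apply: (@triple_search R n d n_gt1 s3 aU vK) => //; rewrite ?sum3 //.
have -> : words s3 vR 0%N = q by [].
move=> s4 [eK [o4 ag4]].
have [ln _ _] := pick_indexP qU; rewrite pick3 in eK; set l := pick_index u n q in ln eK *.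
apply: returns_seq.
have eI4 : words s4 vI 0%N = i by rewrite ag4 //= /upd /= eI2.
have eJ4 : words s4 vJ 0%N = j by rewrite ag4 //= /upd /= eJ.
have eu4 x : words s4 aU x = u x by rewrite ag4 //= /upd /= eu2.
have ew4 x : words s4 aW x = w x by rewrite ag4 //= /upd /= ew2.
rewrite -addnA add1n; apply: (@returns_step _ _ _ _ _ _ _ _
  (update_cmd :: k, State (words s4) (reals s4) ((i, l) :: output s))) => //.
  rewrite /= !mod0n eI4 eK !modn_small ?o4 /= ?o2 //; lia.
apply: (@triple_update R n d n_gt1 _ i j l u w) => //.
move=> s5 [o5 eI5 eu5 ew5 eUW5]; exact: H.
Qed.

End RoundAnalysis.

(** The double sum is a product, because the first factor depends only on [r] and the second only on
    [q]. Summed, they are [U * W + M] and [U * W - M] with the same [M], so the product is at most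
    [(U * W) ^ 2]. *)
Lemma potential_le (R : realType) n (d : 'I_n -> 'I_n -> R) (u w : nat -> nat) i
    (U := (\sum_(x < n) u x)%N) (W := (\sum_(x < n) w x)%N) :
  (\sum_(r < W) \sum_(q < U)
     (\sum_(x < n) double_covering d u i (pick_index w n r) x) *
     (\sum_(x < n) zero_covered d w i (pick_index u n q) x) <= (U * W) * (U * W))%N.
Proof.
pose U' j := (\sum_(x < n) double_covering d u i j x)%N.
pose W' k := (\sum_(x < n) zero_covered d w i k x)%N.
pose M := (\sum_(j < n) w j * \sum_(x < n | covers d i x j) u x)%N.
have EU : (\sum_(r < W) U' (pick_index w n r) = U * W + M)%N.
  rewrite sum_pick_index mulnC /W big_distrl -big_split; apply: eq_bigr => j _ /=.
  rewrite -mulnDr; congr muln.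
  rewrite [X in (_ + X)%N]big_mkcond -big_split; apply: eq_bigr => x _ /=.
  by rewrite /double_covering; case: ifP; rewrite ?addn0.
(* Double counting of the covering pairs: the weight gained, grouped by [j], equals the weight lost,
   grouped by the drawn point. *)
have EM : M = (\sum_(x < n) u x * \sum_(j < n | covers d i x j) w j)%N.
  rewrite /M; under eq_bigr do rewrite big_distrr /=.
  rewrite (exchange_big_dep xpredT) //=; apply: eq_bigr => x _.
  by rewrite big_distrr; apply: eq_bigr => j _; rewrite mulnC.
have EW : (\sum_(q < U) W' (pick_index u n q) + M = U * W)%N.
  rewrite sum_pick_index EM /U big_distrl -big_split.
  apply: eq_bigr => x _ /=; rewrite -mulnDr; congr muln.
  rewrite [X in (_ + X)%N]big_mkcond -big_split; apply: eq_bigr => j _ /=.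
  by rewrite /zero_covered; case: ifP; rewrite ?addn0.
rewrite [leqLHS](_ : _ = ((U * W + M) * \sum_(q < U) W' (pick_index u n q))%N).
  by move: EW; set S := (\sum_(q < U) _)%N => <-; nia.
by rewrite -EU big_distrl; apply: eq_bigr => r _; rewrite big_distrr.
Qed.

(** Linearity of the average turns the integer inequality of [potential_le] into the premise of
    [returns_round]. *)
Lemma average_potential (R : realType) (U W : nat) (f : 'I_W -> nat) (g : 'I_U -> nat) (a N : R) :
  0 < N -> (0 < U)%N -> (0 < W)%N ->
  (\sum_(r < W) \sum_(q < U) f r * g q <= (U * W) * (U * W))%N ->
  a - (U * W)%:R / N <=
  (\sum_(r < W) ((\sum_(q < U) (a - (f r * g q)%:R / N)) / U%:R)) / W%:R.
Proof.
move=> N0 U0 W0 H.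
have U0' : 0 < U%:R :> R by rewrite ltr0n.
have W0' : 0 < W%:R :> R by rewrite ltr0n.
have -> : (\sum_(r < W) ((\sum_(q < U) (a - (f r * g q)%:R / N)) / U%:R)) =
    (a * (U * W)%:R - (\sum_(r < W) \sum_(q < U) f r * g q)%:R / N) / U%:R.
  rewrite -mulr_suml; congr (_ / _).
  under eq_bigr do rewrite sumrB sumr_const card_ord -mulr_suml -natr_sum.
  by rewrite sumrB sumr_const card_ord -mulr_suml -natr_sum -mulrnA mulr_natr.
move: H; set S := (\sum_(r < W) _)%N; rewrite -(ler_nat R) => H.
rewrite ler_pdivlMr // ler_pdivlMr // -mulrA -natrM [(W * U)%N]mulnC mulrBl lerB //.
by rewrite mulrAC ler_pM2r ?invr_gt0 // -natrM.
Qed.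

(** * The loops *)

Section Loops.

Variables (R : realType) (n : nat) (d : 'I_n -> 'I_n -> R).
Hypothesis n_gt1 : (1 < n)%N.
Hypothesis dist_d : distance d.

Local Notation M := (word_modulus 7 n).
Local Notation returns := (returns 7 d).
Local Notation G s := (output_graph n s).
Implicit Types (s : state R).

(** Repeated edges count repeatedly, so this is the number of rounds played for [i] and an upper
    bound on its out-degree. *)
Definition out_count (i : nat) s : nat := count (fun e => e.1 == i) (output s).

Definition covered (E : {set 'I_n * 'I_n}) (i j : 'I_n) : bool :=
  [exists k, ((i, k) \in E) && (d k j < d i j)].

Definition all_covered (E : {set 'I_n * 'I_n}) (i : 'I_n) : bool :=
  [forall j, (i != j) ==> covered E i j].

(** The event whose probability is followed through the outer loop; it is trivial for [m = 0] and is
    navigability for [m = n]. *)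
Definition prefix_covered (m : nat) (E : {set 'I_n * 'I_n}) : bool :=
  [forall i : 'I_n, (i < m)%N ==> all_covered E i].

Definition log_size : nat := (trunc_log 2 n).+1.

Definition round_bound (i : 'I_n) : nat := (5 * log_size * OPTi d i)%N.

Lemma size_lt_log_size : (n < 2 ^ log_size)%N.
Proof. exact: trunc_log_ltn. Qed.

Lemma prefix_coveredS (i : 'I_n) E :
  prefix_covered i.+1 E = prefix_covered i E && all_covered E i.
Proof.
apply/forallP/andP => [H|[/forallP H Hi] j].
  split; last by have := H i; rewrite ltnSn.
  by apply/forallP => j; apply/implyP => ji; apply: (implyP (H j)); apply: ltnW.
apply/implyP; rewrite ltnS leq_eqVlt => /orP[/eqP/val_inj->//|]; exact/implyP.
Qed.

Lemma card_outnbr_count s (i : 'I_n) : (#|outnbr (G s) i| <= out_count i s)%N.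
Proof.
rewrite cardE -(size_map val) /out_count -size_filter.
rewrite -(size_map (fun e : nat * nat => e.2)).
apply: uniq_leq_size; first by rewrite map_inj_uniq ?enum_uniq //; exact: val_inj.
move=> _ /mapP[k kE ->]; move: kE; rewrite mem_enum !inE /= => kE.
by apply/mapP; exists (val i, val k) => //; rewrite mem_filter eqxx.
Qed.

Lemma mem_graph_cons s s' (i l i' k : 'I_n) :
  output s' = (val i, val l) :: output s ->
  ((i', k) \in G s') = ((i' == i) && (k == l)) || ((i', k) \in G s).
Proof. by move=> o; rewrite !inE o inE xpair_eqE. Qed.

Lemma not_covered0 s (i j : 'I_n) : out_count i s = 0%N -> covered (G s) i j = false.
Proof.
move=> c0; apply/existsP => -[k /andP[ik _]].
have := card_outnbr_count s i; rewrite c0 leqn0 cards_eq0 => /eqP/setP/(_ k).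
by rewrite in_set0 in_set ik.
Qed.

Definition outer_inv (m : nat) s : Prop :=
  [/\ words s vI 0%N = m, (m <= n)%N &
      forall i : 'I_n, (out_count i s <= if (i < m)%N then round_bound i else 0)%N].

(** [t] is the number of rounds played for [i]. The bound [2 * n ^ 5] allows for the last round,
    which starts below [n ^ 5] and at most doubles the sum. The bound on the product records one
    doubling inside [C] per round. *)
Definition inner_inv (C : {set 'I_n}) (i : 'I_n) (t : nat) s : Prop :=
  [/\ words s vI 0%N = i,
      [/\ words s vU 0%N = (\sum_(x < n) words s aU x)%N,
          words s vW 0%N = (\sum_(x < n) words s aW x)%N &
          (\sum_(x < n) words s aU x <= 2 * n ^ 5)%N],
      (forall j : 'I_n, words s aW j = (i != j) && ~~ covered (G s) i j),
      (forall x, (x < n)%N -> (0 < words s aU x)%N) /\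
      (2 ^ t <= \prod_(k in C) words s aU k)%N &
      out_count i s = t /\
      forall i' : 'I_n, i' != i ->
        (out_count i' s <= if (i' < i)%N then round_bound i' else 0)%N].

Lemma inner_inv_step (C : {set 'I_n}) (i j l : 'I_n) t s s' :
  (forall x, i != x -> exists2 k, k \in C & d k x < d i x) ->
  inner_inv C i t s -> (\sum_(x < n) words s aU x < n ^ 5)%N ->
  (0 < words s aW j)%N -> after_round d s i j l s' ->
  inner_inv C i t.+1 s'.
Proof.
move=> hC [eI [eU eW _] hw [hu hp] [ct co]] ltU wj [o' eI' eu' ew' [eU' eW']].
have esum : (\sum_(x < n) words s' aU x =
    \sum_(x < n) double_covering d (words s aU) i j x)%N.
  by apply: eq_bigr => x _; rewrite eu'.
split=> //.
- rewrite eU' eW' esum; split=> //; first by apply: eq_bigr => x _; rewrite ew'.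
  by apply: leq_trans (sum_double_covering _ _ _ _ _) _; rewrite leq_mul2l ltnW.
- move=> x; rewrite ew' // /zero_covered /covers !dist_nat_ord hw.
  have -> : covered (G s') i x = (d l x < d i x) || covered (G s) i x.
    apply/existsP/orP => [[k]|[lx|/existsP[k /andP[ik kx]]]].
    - rewrite (mem_graph_cons _ _ o') eqxx /= => /andP[/orP[/eqP->|ik] kx]; first by left.
      by right; apply/existsP; exists k; rewrite ik.
    - by exists l; rewrite (mem_graph_cons _ _ o') !eqxx.
    - by exists k; rewrite (mem_graph_cons _ _ o') ik orbT.
  by case: ifP => //= _; rewrite andbF.
- split=> [x xn|].
    by rewrite eu' // /double_covering; case: ifP => _; have := hu x xn; lia.
  (* The drawn [j] is uncovered, hence differs from [i], so some [k0] in [C] covers it. Its weight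
     doubles and no other weight drops. *)
  have ij : i != j by move: wj; rewrite hw; case: (i != j).
  have [k0 k0C k0j] := hC _ ij.
  rewrite (bigD1 k0) //= expnS eu' // /double_covering /covers !dist_nat_ord k0j addnn -mul2n.
  rewrite -mulnA leq_mul2l /=; apply: leq_trans hp _; rewrite (bigD1 k0) //= leq_mul2l.
  apply/orP; right; apply: leq_prod => k _; rewrite eu' // /double_covering.
  by case: ifP => // _; apply: leq_addr.
- split=> [|i' i'i]; rewrite /out_count o' /=; first by rewrite eqxx -/(out_count _ _) ct.
  have -> : (val i == val i') = false by rewrite eq_sym; apply/negbTE.
  exact: co.
Qed.

(** The new edge leaves [i], which is not among the points before [i]. *)
Lemma prefix_covered_step (i l : 'I_n) s s' :
  output s' = (val i, val l) :: output s ->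
  prefix_covered i (G s') = prefix_covered i (G s).
Proof.
move=> o'; apply: eq_forallb => i'; case: ltnP => //= i'i.
apply: eq_forallb => j; congr (_ ==> _); apply: eq_existsb => k.
rewrite (mem_graph_cons _ _ o').
by have -> : (i' == i) = false by apply/negbTE; rewrite neq_ltn i'i.
Qed.

(* Every round doubles the weight of some set of the cover [C], while all
   weights stay below [n ^ 5] as long as the loop goes on. *)
Lemma rounds_lt (C : {set 'I_n}) (i : 'I_n) t s :
  #|C| = OPTi d i -> inner_inv C i t s ->
  (\sum_(x < n) words s aU x < n ^ 5)%N -> (t < round_bound i)%N.
Proof.
move=> cC [_ _ _ [hu hp] _] lt.
have C0 : (0 < #|C|)%N by rewrite cC OPTi_gt0.
rewrite -(ltn_exp2l _ _ (ltnSn 1)); apply: leq_ltn_trans hp _.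
apply: (@leq_ltn_trans ((n ^ 5) ^ #|C|)).
  rewrite -prod_nat_const; apply: leq_prod => k _; apply: leq_trans (ltnW lt).
  exact: leq_term_psum.
rewrite /round_bound -cC [(5 * log_size)%N]mulnC -mulnA -expnM [(2 ^ _)%N]expnM.
by rewrite ltn_exp2r ?size_lt_log_size // muln_gt0 C0.
Qed.

Lemma inner_inv_uncovered_le (C : {set 'I_n}) (i : 'I_n) t s :
  inner_inv C i t s -> (\sum_(x < n) words s aW x <= n)%N.
Proof.
move=> [_ _ hw _ _]; rewrite -[X in (_ <= X)%N](card_ord n) -sum1_card.
by apply: leq_sum => x _; rewrite hw; case: (_ && _).
Qed.

Lemma cover_cond (C : {set 'I_n}) (i : 'I_n) t s : inner_inv C i t s ->
  beval 7 d s (BAnd (BWLt (WConst 0) $vW) (BWLt $vU size_pow5)) =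
  (0 < \sum_(x < n) words s aW x)%N && (\sum_(x < n) words s aU x < n ^ 5)%N.
Proof.
move=> Inv; have Wn := inner_inv_uncovered_le Inv.
have [_ [eU eW UB] _ _ _] := Inv.
have p5M := pow5_lt_modulus n_gt1; have nM := size_lt_modulus n_gt1.
by rewrite bevalA !bevalLt weval0 weval_pow5 // !weval_var ?eU ?eW //; lia.
Qed.

(** Markov's inequality at the exit of the loop: either [W = 0], so [i] is covered and the potential
    vanishes, or [U >= n ^ 5] and [W >= 1], so the potential term is at least 1 and the guarantee is
    void. *)
Lemma cover_exit (C : {set 'I_n}) (i : 'I_n) t s (a x : R)
    (U := (\sum_(y < n) words s aU y)%N) (W := (\sum_(y < n) words s aW y)%N) :
  inner_inv C i t s -> ~~ ((0 < W)%N && (U < n ^ 5)%N) -> 0 <= x ->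
  (prefix_covered i (G s))%:R - (U * W)%:R / n%:R ^+ 5 - x <=
  (prefix_covered i.+1 (G s))%:R - x :> R.
Proof.
move=> [_ _ hw _ _] nc x0; rewrite lerD2r; case: (posnP W) => [W0|W0].
  rewrite W0 muln0 mul0r subr0 prefix_coveredS.
  have -> : all_covered (G s) i; last by rewrite andbT.
  apply/forallP => j; apply/implyP => ij.
  have := leq_term_psum (words s aW) (ltn_ord j); rewrite -/W W0 leqn0 hw ij.
  by case: covered.
move: nc; rewrite W0 /= -leqNgt => U5.
have n5 : 0 < n%:R ^+ 5 :> R by rewrite exprn_gt0 // ltr0n ltnW.
have : 1 <= (U * W)%:R / n%:R ^+ 5 :> R.
  rewrite ler_pdivlMr // mul1r -natrX ler_nat; apply: leq_trans U5 _.
  exact: leq_pmulr.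
have : (prefix_covered i (G s))%:R <= 1 :> R by case: prefix_covered; rewrite ?lexx ?ler01.
have : 0 <= (prefix_covered i.+1 (G s))%:R :> R by exact: ler0n.
by lra.
Qed.

(** Induction on the number [m] of rounds left. The guarantee decreases with the potential, which
    does not grow on average; [x] sets aside the failure probability of the stages to come. *)
Lemma returns_cover_loop (C : {set 'I_n}) (i : 'I_n) T Q k m t s p x :
  #|C| = OPTi d i ->
  (forall j, i != j -> exists2 k, k \in C & d k j < d i j) ->
  (t + m)%N = round_bound i -> inner_inv C i t s -> 0 <= x ->
  p <= (prefix_covered i (G s))%:R -
       ((\sum_(y < n) words s aU y) * (\sum_(y < n) words s aW y))%:R / n%:R ^+ 5 - x ->
  (forall s' p', words s' vI 0%N = i ->
     (forall i' : 'I_n, (out_count i' s' <= if (i' < i.+1)%N then round_bound i' else 0)%N) ->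
     p' <= (prefix_covered i.+1 (G s'))%:R - x -> returns T Q p' (k, s')) ->
  returns (m * (n * 23 + 22) + 1 + T) Q p (cover_cmd :: k, s).
Proof.
move=> cC hC + + x0 + H; elim: m t s p => [|m IH] t s p tm Inv pp.
all: have Wn := inner_inv_uncovered_le Inv; have cond := cover_cond Inv.
all: have [eI [eU eW UB] hw [hu hp] [ct co]] := Inv.
- apply: (@returns_leq _ _ _ _ T.+1); first by lia.
  apply: returns_step => //; rewrite cond.
  (* With no round left, [rounds_lt] contradicts the loop test, so the loop ends here. *)
  case: ifP => [/andP[_ /(rounds_lt cC Inv)]|/negbT nc]; first by lia.
  apply: H => // [i'|]; last by apply: le_trans pp _; apply: (cover_exit 0 Inv nc).
  case: (eqVneq i' i) => [->|/co]; first by rewrite ltnSn ct; lia.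
  by rewrite ltnS; case: (ltnP i' i) => [/ltnW->|_] //; rewrite leqn0 => /eqP->.
- apply: (@returns_leq _ _ _ _ (n * 23 + 21 + (m * (n * 23 + 22) + 1 + T)).+1); first by lia.
  apply: returns_step => //; rewrite cond.
  case: ifP => [/andP[W0 U5]|/negbT nc]; last first.
    apply: (@returns_leq _ _ _ _ T); first by lia.
    apply: H => // [i'|]; last by apply: le_trans pp _; apply: (cover_exit 0 Inv nc).
    case: (eqVneq i' i) => [->|/co]; first by rewrite ltnSn ct; lia.
    by rewrite ltnS; case: (ltnP i' i) => [/ltnW->|_] //; rewrite leqn0 => /eqP->.
  have p5M := pow5_lt_modulus n_gt1; have nM := size_lt_modulus n_gt1.
  have U0 : (0 < \sum_(y < n) words s aU y)%N.
    by apply: leq_trans (leq_term_psum _ (ltn_ord i)); apply: hu.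
  pose a : R := (prefix_covered i (G s))%:R - x.
  pose pf j l : R := a - ((\sum_(y < n) double_covering d (words s aU) i j y) *
                     (\sum_(y < n) zero_covered d (words s aW) i l y))%:R / n%:R ^+ 5.
  apply: (@returns_round _ _ d n_gt1 _ _ _ _ i _ pf) => //; try lia.
    move=> j l s' jn ln wj Hs'.
    have Inv' := @inner_inv_step C i (Ordinal jn) (Ordinal ln) t s s' hC Inv U5 wj Hs'.
    apply: (IH _ _ _ _ Inv'); first by lia.
    have [o' _ eu' ew' _] := Hs'.
    rewrite (@prefix_covered_step i (Ordinal ln) _ _ o').
    have -> : (\sum_(y < n) words s' aU y =
        \sum_(y < n) double_covering d (words s aU) i j y)%N by apply: eq_bigr => y _; apply: eu'.
    have -> : (\sum_(y < n) words s' aW y =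
        \sum_(y < n) zero_covered d (words s aW) i l y)%N by apply: eq_bigr => y _; apply: ew'.
    by rewrite /pf /a addrAC.
  apply: le_trans (average_potential a _ U0 W0 (potential_le d (words s aU) (words s aW) i)).
    by rewrite /a addrAC.
  by rewrite exprn_gt0 // ltr0n ltnW.
Qed.

End Loops.

(** * The stages for the single points, put together *)

Section Algorithm.

Variables (R : realType) (n : nat) (d : 'I_n -> 'I_n -> R).
Hypothesis n_gt1 : (1 < n)%N.
Hypothesis dist_d : distance d.

Local Notation M := (word_modulus 7 n).
Local Notation returns := (returns 7 d).
Local Notation G s := (output_graph n s).
Implicit Types (s : state R).

Definition stage_time (i : 'I_n) : nat :=
  (n * 7 + 14 + round_bound d i * (n * 23 + 22))%N.

Lemma inner_inv_init (C : {set 'I_n}) (i : 'I_n) s s' :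
  outer_inv d i s ->
  [/\ output s' = output s, words s' vI 0%N = i,
      (forall x, (x < n)%N -> words s' aU x = 1%N),
      (forall x, (x < n)%N -> words s' aW x = (x != i)) &
      words s' vU 0%N = n /\ words s' vW 0%N = n.-1] ->
  inner_inv d C i 0 s' /\
  ((\sum_(y < n) words s' aU y) * (\sum_(y < n) words s' aW y) = n * n.-1)%N.
Proof.
move=> [eI _ co] [o' eI' eu ew [eU eW]].
have sU : (\sum_(y < n) words s' aU y = n)%N.
  rewrite (eq_bigr (fun=> 1%N)) => [|y _]; last exact: eu.
  by rewrite sum1_card card_ord.
have sW : (\sum_(y < n) words s' aW y = n.-1)%N.
  rewrite (eq_bigr (fun y : 'I_n => if y != i then 1 else 0)%N) => [|y _].
    by rewrite -big_mkcond sum1_card cardC1 card_ord.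
  by rewrite ew // -val_eqE; case: (val y != i).
have oc i' : out_count i' s' = out_count i' s by rewrite /out_count o'.
have c0 : out_count i s' = 0%N by have := co i; rewrite ltnn oc leqn0 => /eqP.
split; last by rewrite sU sW.
split=> //.
- rewrite sU sW eU eW; split=> //.
  apply: leq_trans (_ : n ^ 5 <= _)%N; first by rewrite -{1}[n]expn1 leq_exp2l.
  exact: leq_pmull.
- by move=> j; rewrite ew // not_covered0 // andbT eq_sym.
- split=> [x xn|]; first by rewrite eu.
  by rewrite big1 // => k _; rewrite eu.
- by split=> // i' _; rewrite oc; apply: co.
Qed.

(** The union bound, carried along the loop: each of the [m] remaining points may cost
    [1 / n ^ 3]. *)
Lemma returns_build T Q k m l s p :
  (l + m)%N = n -> outer_inv d l s ->
  p <= (prefix_covered d l (G s))%:R - m%:R / n%:R ^+ 3 ->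
  (forall s' p', outer_inv d n s' -> p' <= (prefix_covered d n (G s'))%:R ->
     returns T Q p' (k, s')) ->
  returns (\sum_(i < n | (l <= i)%N) stage_time i + 1 + T) Q p (build_cmd :: k, s).
Proof.
move=> + + + H; have nM := size_lt_modulus n_gt1.
elim: m l s p => [|m IH] l s p lm Inv pp; have [eI ln co] := Inv.
  have el : l = n by lia.
  apply: (@returns_leq _ _ _ _ T.+1); first by lia.
  apply: returns_step => //; rewrite bevalLt weval_size // weval_var eI; last by lia.
  rewrite el ltnn; rewrite el mul0r subr0 in Inv pp.
  exact: H Inv pp.
have ltn : (l < n)%N by lia.
pose i := Ordinal ltn.
have [C cC hC] := OPTi_cover dist_d i.
rewrite (bigD1 i) //= (eq_bigl (fun j : 'I_n => l.+1 <= j)%N); last first.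
  by move=> j; rewrite ltn_neqAle andbC eq_sym.
set F := (\sum_(j < n | _) _)%N.
apply: (@returns_leq _ _ _ _ ((n * 7 + 9) + (round_bound d i * (n * 23 + 22) + 1 +
  (1 + (F + 1 + T))).+1).+2).
  by rewrite /stage_time; lia.
apply: returns_step => //; rewrite bevalLt weval_size // weval_var eI ?ltn; last by lia.
apply: returns_seq.
apply: (@triple_init R n d n_gt1 s l) => // s1 init1.
have [Inv1 sum1] := @inner_inv_init C i s s1 Inv init1.
apply: returns_seq.
have n0 : 0 < n%:R :> R by rewrite ltr0n ltnW.
apply: (returns_cover_loop n_gt1 dist_d cC hC (x := m%:R / n%:R ^+ 3) _ Inv1) => //.
- by rewrite divr_ge0 ?exprn_ge0 ?ler0n.
- rewrite sum1 /=; have [o1 _ _ _ _] := init1.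
  have -> : G s1 = G s by rewrite /output_graph o1.
  apply: le_trans pp _; rewrite -addrA lerD2l -opprD lerN2.
  (* The initial potential of this stage uses up one share of the failure probability; the other [m]
     shares are the [x] above. *)
  have : (n * n.-1)%:R / n%:R ^+ 5 <= 1 / n%:R ^+ 3 :> R.
    rewrite ler_pdivrMr ?exprn_gt0 // mulrAC ler_pdivlMr ?exprn_gt0 // mul1r.
    by rewrite -!natrX -natrM ler_nat !expnS; nia.
  by rewrite -natr1 mulrDl addrC lerD2l.
- move=> s2 p2 eI2 co2 pp2; apply: returns_step => //.
  have iM : (i < M)%N by apply: ltn_trans nM.
  rewrite weval0 (weval_add (a := l) (b := 1)) ?weval1 ?weval_var ?eI2 //; last by lia.
  rewrite [(l + 1)%N]addn1; apply: (IH l.+1) => //; first by lia.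
Qed.

End Algorithm.

(** * From [log_size] to [ln], and the numerical constants *)

Section Bounds.

Variables (R : realType) (n : nat).
Hypothesis n_gt1 : (1 < n)%N.

Lemma ln_size_gt0 : 0 < ln n%:R :> R.
Proof. by rewrite ln_gt0 // ltr1n. Qed.

(** The factor 2 absorbs the successor in [log_size], as [trunc_log 2 n] is at least 1 for
    [n > 1]. *)
Lemma log_size_le : (log_size n)%:R <= 2 / ln 2 * ln n%:R :> R.
Proof.
have l2 : 0 < ln 2 :> R by rewrite ln_gt0 // ltr1n.
rewrite mulrAC ler_pdivlMr // /log_size.
have t1 : (1 <= trunc_log 2 n)%N by rewrite trunc_log_gt0.
have : (trunc_log 2 n)%:R * ln 2 <= ln n%:R :> R.
  rewrite mulr_natl -lnXn // ler_ln ?posrE ?exprn_gt0 ?ltr0n //; last exact: ltnW.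
  by rewrite -natrX ler_nat trunc_logP // ltnW.
have : (trunc_log 2 n).+1%:R <= 2 * (trunc_log 2 n)%:R :> R.
  by rewrite -natrM ler_nat; lia.
by nra.
Qed.

(** The constant 6 is the 3 of [OPT_upper] times the 2 in [q <= 2 * sqrt n]. *)
Lemma size_log_size_OPT_le (d : 'I_n -> 'I_n -> R) :
  distance d -> general_position d ->
  (n * OPT d)%:R <= 6 * n%:R `^ (5 / 2) * (log_size n)%:R :> R.
Proof.
move=> dist_d gen_d; have n0 : (0 < n)%N by apply: ltnW.
have [q nq q4] := sqrt_ceil n0.
have H := OPT_upper dist_d gen_d n0 nq (size_lt_log_size n).
have q2 : q%:R <= 2 * Num.sqrt n%:R :> R.
  rewrite -[q%:R](ger0_norm (ler0n _ _)) -sqrtr_sqr.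
  have -> : 2 = Num.sqrt 4 :> R.
    by rewrite (_ : 4 = 2 ^+ 2) ?sqrtr_sqr ?ger0_norm //; ring.
  rewrite -sqrtrM // ler_wsqrtr // -natrX -natrM ler_nat.
  by rewrite -mulnn.
have -> : n%:R `^ (5 / 2) = n%:R ^+ 2 * Num.sqrt n%:R :> R.
  rewrite (_ : 5 / 2 = 2%:R + 2^-1); last by field.
  rewrite powRD; last by rewrite pnatr_eq0 -lt0n n0 implybT.
  by rewrite powR_mulrn // powR12_sqrt.
apply: (@le_trans _ _ (n%:R * (3 * n%:R * q%:R * (log_size n)%:R))).
  by rewrite natrM ler_wpM2l // -!natrM ler_nat.
rewrite (_ : n%:R * _ = 3 * n%:R ^+ 2 * (log_size n)%:R * q%:R); last by ring.
rewrite (_ : 6 * _ * _ = 3 * n%:R ^+ 2 * (log_size n)%:R * (2 * Num.sqrt n%:R)); last by ring.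
by rewrite ler_wpM2l // !mulr_ge0 ?exprn_ge0.
Qed.

(** For [n >= 2], [7 n + 14 <= 14 n] and [23 n + 22 <= 34 n], so already [14 + 5 * 34 = 184] would
    do. *)
Lemma stage_time_le (d : 'I_n -> 'I_n -> R) i : distance d ->
  (stage_time d i <= 200 * n * log_size n * OPTi d i)%N.
Proof.
move=> dist_d; rewrite /stage_time /round_bound.
have := OPTi_gt0 dist_d i n_gt1; have : (0 < log_size n)%N by [].
move: (log_size n) (OPTi d i) => L o L0 o0.
have Lo : (0 < L * o)%N by rewrite muln_gt0 L0.
rewrite -[(5 * L * o)%N]mulnA -[(_ * L * o)%N]mulnA; move: (L * o)%N Lo => z z0.
by nia.
Qed.

End Bounds.

Theorem theorem4p11 (R : realType) :
  exists (P : cmd) (c : nat) (C : R) (k : nat),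
  forall (n : nat) (d : 'I_n -> 'I_n -> R),
    (1 < n)%N -> distance d -> general_position d ->
    (exists t : nat,
      [/\ runs_within P c d t,
          t%:R <= C * (n * OPT d)%:R * ln n%:R ^+ k
        & 1 - 1 / n%:R ^+ 2 <=
            prob_returns P c d t (fun E : {set 'I_n * 'I_n} =>
              [&& navigable d E,
                  #|E|%:R <= C * (OPT d)%:R * ln n%:R
                & [forall i, #|outnbr E i|%:R <=
                               C * (OPTi d i)%:R * ln n%:R]])]) /\
    (n * OPT d)%:R <= C * n%:R `^ (5 / 2) * ln n%:R ^+ k.
Proof.
pose K : R := 2 / ln 2.
have K0 : 0 <= K by rewrite divr_ge0 // ln_ge0 // ler1n.
(* 201 is the 200 of [stage_time_le] plus 1 for the last test of the outer loop; [K] converts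
   [log_size] into [ln]. *)
exists build_cmd, 7%N, (201 * K), 1%N => n d n_gt1 dist_d gen_d.
have LK : (log_size n)%:R <= K * ln n%:R := log_size_le R n_gt1.
have [ln0 L0] : 0 <= ln n%:R :> R /\ 0 <= (log_size n)%:R :> R.
  by rewrite ltW ?ln_size_gt0.
have O1 : (n <= OPT d)%N.
  apply: leq_trans (sum_OPTi_le dist_d); rewrite -[X in (X <= _)%N](card_ord n) -sum1_card.
  by apply: leq_sum => i _; apply: OPTi_gt0.
rewrite expr1; split; last first.
  apply: le_trans (size_log_size_OPT_le n_gt1 dist_d gen_d) _.
  have p0 : 0 <= n%:R `^ (5 / 2) :> R := powR_ge0 _ _.
  rewrite [X in _ <= X](_ : _ = 201 * n%:R `^ (5 / 2) * (K * ln n%:R)); last by ring.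
  by apply: ler_pM => //; rewrite ?mulr_ge0 // ler_wpM2r // ler_nat.
pose t := (\sum_(i < n | (0 <= i)%N) stage_time d i + 1 + 0)%N.
pose Q (E : {set 'I_n * 'I_n}) := [&& navigable d E,
  #|E|%:R <= 201 * K * (OPT d)%:R * ln n%:R
  & [forall i, #|outnbr E i|%:R <= 201 * K * (OPTi d i)%:R * ln n%:R]].
have [run prob] : returns 7 d t (fun s => Q (output_graph n s)) (1 - 1 / n%:R ^+ 2)
    ([:: build_cmd], init_state R).
  apply: (returns_build n_gt1 dist_d (m := n) (l := 0)) => //.
  (* No point precedes the first, so the guarantee starts at [1 - n / n ^ 3]. *)
  - rewrite (_ : prefix_covered _ _ _); last by apply/forallP.
    rewrite (_ : n%:R / n%:R ^+ 3 = 1 / n%:R ^+ 2 :> R) //.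
    by field; rewrite pnatr_eq0 -lt0n ltnW.
  move=> s' p' [_ _ co] pp; apply: returns_halted; apply: le_trans pp _.
  rewrite ler_nat; case cov: prefix_covered => //.
  have deg i : (#|outnbr (output_graph n s') i| <= 5 * log_size n * OPTi d i)%N.
    by apply: leq_trans (card_outnbr_count _ _) _; have := co i; rewrite ltn_ord.
  have bnd (a b : nat) : (a <= 5 * log_size n * b)%N ->
      a%:R <= 201 * K * b%:R * ln n%:R :> R.
    rewrite -(ler_nat R) => /le_trans; apply.
    rewrite [X in _ <= X](_ : _ = 201 * (K * ln n%:R) * b%:R); last by ring.
    by rewrite !natrM ler_wpM2r // ler_pM // ler_nat.
  suff : Q (output_graph n s') by move->.
  apply/and3P; split.
  - apply/navigableP => // i j ij.
    have /forallP/(_ j) := implyP (forallP cov i) (ltn_ord i).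
    by rewrite ij => /existsP[k /andP[ik kj]]; exists k; rewrite // in_set.
  - apply: bnd; rewrite card_edges.
    apply: (@leq_trans (\sum_i 5 * log_size n * OPTi d i)); first exact: leq_sum.
    by rewrite -big_distrr leq_mul2l sum_OPTi_le ?orbT.
  - by apply/forallP => i; apply: bnd.
exists t; split=> //.
have -> : 201 * K * (n * OPT d)%:R * ln n%:R = 201 * (n * OPT d)%:R * (K * ln n%:R) :> R by ring.
apply: (@le_trans _ _ (201 * (n * OPT d)%:R * (log_size n)%:R)); last first.
  by rewrite ler_wpM2l ?mulr_ge0.
rewrite -!natrM ler_nat /t.
apply: (@leq_trans (200 * n * log_size n * OPT d + 1)).
  rewrite addn0 leq_add2r.
  apply: (@leq_trans (\sum_i 200 * n * log_size n * OPTi d i)).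
    by apply: leq_sum => i _; apply: stage_time_le.
  by rewrite -big_distrr leq_mul2l sum_OPTi_le ?orbT.
have : (0 < n * log_size n * OPT d)%N by rewrite !muln_gt0 (ltnW n_gt1) (leq_trans (ltnW n_gt1) O1).
move: (log_size n) (OPT d) => L o.
rewrite (_ : 200 * n * L * o = 200 * (n * L * o))%N; last by ring.
rewrite (_ : 201 * (n * o) * L = 201 * (n * L * o))%N; last by ring.
by lia.
Qed.
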